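(* Let $n \ge 1$ and consider $\mathbb{Z}^n$ with the rectangular partial order ($\mathbf{x} \le \mathbf{y}$ iff $x_i \le y_i$ for all $i$), whose positive cone is $\mathbb{N}_0^n \setminus\{\mathbf{0}\}$. Let $\mathcal{J}$ be the set of all downward closed nonempty finite subsets of $\mathbb{N}_0^n\setminus\{\mathbf{0}\}$, and for $A \subseteq \mathbb{Z}^n$ let $\sigma_{\mathcal{J}}(A) = \inf\{ |A\cap J|/|J| : J \in \mathcal{J}\}$. If $A$ and $B$ are subsets of $\mathbb{N}_0^n\setminus\{\mathbf{0}\}$ with $\sigma_{\mathcal{J}}(A) = \alpha$ and $\sigma_{\mathcal{J}}(B) = \beta$, then \[ \sigma_{\mathcal{J}}(A+B) \ge \alpha + \beta - \alpha\beta, \] where $A + B = \{\mathbf{a}+\mathbf{b} : \mathbf{a} \in A \cup\{\mathbf{0}\},\ \mathbf{b} \in B\cup\{\mathbf{0}\}\}$.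
   Context: $\mathbb{N}_0 = \{0,1,2,\dots\}$. We write $\mathbf{x}<\mathbf{y}$ if $\mathbf{x}\le\mathbf{y}$ and $\mathbf{x}\ne\mathbf{y}$. A subset $J \subseteq \mathbb{N}_0^n\setminus\{\mathbf{0}\}$ is downward closed if $\mathbf{x} \in J$ implies $\{\mathbf{y} \in \mathbb{Z}^n : \mathbf{0} < \mathbf{y} < \mathbf{x}\} \subseteq J$. *)

(* Defs.v *)
From HB Require Import structures.
From mathcomp Require Export all_boot all_order all_algebra finmap.
From mathcomp Require Export boolp classical_sets reals.

Set Implicit Arguments.
Unset Strict Implicit.
Unset Printing Implicit Defensive.

Import Order.TTheory GRing.Theory Num.Theory.

Local Open Scope ring_scope.
Local Open Scope classical_set_scope.

(* The rectangular order on Z^n, with Z^n as integer row vectors; MathComp puts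
   no order on matrices. *)
Definition lev (n : nat) (x y : 'rV[int]_n) : Prop :=
  forall i, x ord0 i <= y ord0 i.

Definition ltv (n : nat) (x y : 'rV[int]_n) : Prop := lev x y /\ x <> y.

(* N_0^n \ {0} *)
Definition pos_cone (n : nat) : set 'rV[int]_n := [set x | ltv 0 x].

Definition downward_closed (n : nat) (J : {fset 'rV[int]_n}) : Prop :=
  forall x y, x \in J -> ltv 0 y -> ltv y x -> y \in J.

Definition down_sets (n : nat) : set {fset 'rV[int]_n} :=
  [set J | [/\ J != fset0, [set` J] `<=` @pos_cone n & downward_closed J]].

(* sigma_J(A), the infimum of |A n J| / |J|. For n >= 1 the set of ratios is
   nonempty (and it is bounded below by 0), so inf is the true infimum. *)
Definition density (R : realType) (n : nat) (A : set 'rV[int]_n) : R :=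
  inf [set (#|` [fset x in J | x \in A]%fset|%:R / #|` J|%:R : R)
      | J in @down_sets n].

Definition sumset (n : nat) (A B : set 'rV[int]_n) : set 'rV[int]_n :=
  [set a + b | a in A `|` [set 0] & b in B `|` [set 0]].

(* Main.v *)
(** Let [J] be a finite down-set and extend the rectangular order to a total
    order (the lexicographic one).  Send each [x] of [J \ A] to the largest
    element [f x] of [(A n J) u {0}] below [x].  Whenever [f x <= y <= x] one has
    [f y = f x]; hence each fibre of [f], translated by minus its base point, is
    again a down-set (or empty) and contains at least the proportion [beta] of
    elements of [B].  These elements yield distinct points of [A + B] outside [A],
    so [|(A + B) n J| >= |A n J| + beta (|J| - |A n J|)
    = (1 - beta) |A n J| + beta |J| >= (alpha + beta - alpha beta) |J|]. *)
Require Import Defs.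
From mathcomp Require Import ring.

Set Implicit Arguments.
Unset Strict Implicit.
Unset Printing Implicit Defensive.
Import Order.TTheory GRing.Theory Num.Theory.
Local Open Scope ring_scope.
Local Open Scope classical_set_scope.

Lemma lev_refl (n : nat) (x : 'rV[int]_n) : lev x x.
Proof. by move=> i. Qed.

Lemma lev_trans (n : nat) (x y z : 'rV[int]_n) : lev x y -> lev y z -> lev x z.
Proof. by move=> xy yz i; apply: le_trans (xy i) (yz i). Qed.

Lemma lev_subr (n : nat) (a x y : 'rV[int]_n) :
  lev (x - a) (y - a) <-> lev x y.
Proof.
by split=> h i; move: (h i); rewrite !mxE lerD2r.
Qed.

(** The sequence encoding borrows the total lexicographic order of [seqlexi int], which extends
    [lev]. *)
Definition lexkey (n : nat) (x : 'rV[int]_n) : seqlexi int :=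
  [seq x ord0 i | i <- enum 'I_n].

Lemma lexkey_inj (n : nat) : injective (@lexkey n).
Proof.
move=> x y /eq_in_map xy; apply/rowP => i.
by apply: xy; rewrite mem_enum.
Qed.

Lemma lexkey_homo (n : nat) (x y : 'rV[int]_n) :
  lev x y -> (lexkey x <= lexkey y)%O.
Proof.
move=> xy; rewrite /lexkey; elim: (enum 'I_n) => [|i s IH] //=.
by rewrite lexi_cons xy; apply/implyP.
Qed.

Lemma seq_argmax (d : Order.disp_t) (K : orderType d) (T : eqType) (g : T -> K)
    (s : seq T) :
  s != [::] -> exists2 m, m \in s & {in s, forall y, (g y <= g m)%O}.
Proof.
elim: s => // x [|z s] IH _.
  by exists x; rewrite ?mem_head// => y; rewrite inE => /eqP ->.
have [//|m ms mP] := IH.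
have [le_xm|lt_mx] := leP (g x) (g m).
  exists m; first by rewrite inE ms orbT.
  by move=> y; rewrite inE => /predU1P[->//|/mP].
exists x; first by rewrite mem_head.
by move=> y; rewrite inE => /predU1P[->//|/mP/le_trans]; apply; apply: ltW.
Qed.

(** Let [f x] be the element of [D] below [x] with greatest [lexkey]. If [f x] is below [y] and [y]
    below [x], then [f x] competes for [f y] and [f y] for [f x], so their keys agree and
    injectivity gives equality. A point of [D] is its own best candidate because the key is
    monotone. *)
Lemma base_point_exists (n : nat) (D : {fset 'rV[int]_n}) :
    0 \in D -> (forall a, a \in D -> lev 0 a) ->
  exists f : 'rV[int]_n -> 'rV[int]_n,
    [/\ forall x, lev 0 x -> f x \in D /\ lev (f x) x,
        forall x y, lev 0 x -> lev (f x) y -> lev y x -> f y = f x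
      & forall a, a \in D -> f a = a].
Proof.
move=> D0 Dge0.
have /choice[f fP] (x : 'rV[int]_n) : exists a, lev 0 x ->
    [/\ a \in D, lev a x
      & forall b, b \in D -> lev b x -> (lexkey b <= lexkey a)%O].
  (* Outside the nonnegative orthant the requirement is vacuous, and [0] is a dummy value. *)
  have [x0|nx0] := pselect (lev 0 x); last by exists 0.
  have [|a] := @seq_argmax _ _ _ (@lexkey n) [seq a <- D | `[< lev a x >]].
    by rewrite -has_filter; apply/hasP; exists 0 => //; apply/asboolP.
  rewrite mem_filter => /andP[/asboolP ax aD] amax.
  exists a => _; split=> // b bD bx; apply: amax.
  by rewrite mem_filter bD andbT; apply/asboolP.
exists f; split.
- by move=> x /fP[].
- move=> x y x0 fxy yx; have [fxD fxx fxmax] := fP x x0.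
  have [fyD fyy fymax] := fP y (lev_trans (Dge0 _ fxD) fxy).
  apply: lexkey_inj; apply/le_anti/andP; split.
    by apply: fxmax => //; apply: lev_trans yx.
  exact: fymax.
- move=> a aD; have [faD faa famax] := fP a (Dge0 _ aD).
  apply: lexkey_inj; apply/le_anti/andP; split; first exact: lexkey_homo.
  exact/famax/lev_refl.
Qed.

Lemma card_fset_pred (R : pzSemiRingType) (T : choiceType) (J : {fset T})
    (P : pred T) :
  #|` [fset x in J | P x]%fset|%:R = \sum_(x <- J) (P x)%:R :> R.
Proof.
rewrite card_fset_sum1 big_fset /= natr_sum big_mkcond /=.
by apply: eq_bigr => x _; case: (P x).
Qed.

Lemma card_fset_le (T : choiceType) (J : {fset T}) (P : pred T) :
  (#|` [fset x in J | P x]%fset| <= #|` J|)%N.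
Proof. by apply/fsubset_leq_card/fsubsetP => x; rewrite !inE => /andP[]. Qed.

Lemma density_le_ratio (R : realType) (n : nat) (A : set 'rV[int]_n)
    (J : {fset 'rV[int]_n}) : @down_sets n J ->
  density R A <= #|` [fset x in J | x \in A]%fset|%:R / #|` J|%:R.
Proof.
move=> dJ; apply: ge_inf; last by exists J.
by exists 0 => _ [K _ <-]; rewrite divr_ge0.
Qed.

Lemma density_le1 (R : realType) (n : nat) (A : set 'rV[int]_n)
    (J : {fset 'rV[int]_n}) : @down_sets n J -> density R A <= 1.
Proof.
move=> dJ; apply: le_trans (density_le_ratio R A dJ) _.
case: dJ => J0 _ _; rewrite ler_pdivrMr ?ltr0n ?cardfs_gt0// mul1r ler_nat.
exact: card_fset_le.
Qed.

(** Clearing the denominator lets the bound cover the empty set too, as is needed for fibres that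
    may be empty. *)
Lemma density_mul_card_le (R : realType) (n : nat) (A : set 'rV[int]_n)
    (J : {fset 'rV[int]_n}) :
  [set` J] `<=` @pos_cone n -> downward_closed J ->
  density R A * #|` J|%:R <= \sum_(x <- J) (x \in A)%:R.
Proof.
move=> Jpos Jdown; have [->|J0] := eqVneq J fset0.
  by rewrite cardfs0 mulr0 big_seq_fset0.
rewrite -card_fset_pred -ler_pdivlMr ?ltr0n ?cardfs_gt0//.
exact: density_le_ratio.
Qed.

(** The fibre [F] of [f] over [a], shifted by [- a], is a set [K] that is empty or a down-set, so
    the density of [B] bounds the share of [B] in [K]. *)
Lemma fibre_density (R : realType) (n : nat) (A B : set 'rV[int]_n)
    (J : {fset 'rV[int]_n}) (f : 'rV[int]_n -> 'rV[int]_n) (a : 'rV[int]_n)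
    (D := (0 |` [fset x in J | x \in A])%fset)
    (N := [fset x in J | x \notin A]%fset) :
    @down_sets n J ->
    (forall x, lev 0 x -> f x \in D /\ lev (f x) x) ->
    (forall x y, lev 0 x -> lev (f x) y -> lev y x -> f y = f x) ->
    (forall b, b \in D -> f b = b) ->
  density R B * \sum_(x <- N | f x == a) 1
    <= \sum_(x <- N | f x == a) (x - f x \in B)%:R.
Proof.
move=> [J0 Jpos Jdown] fD fconst fid.
pose F := [fset x in N | f x == a]%fset.
pose K := [fset x - a | x in F]%fset.
have subI : {in F &, injective (fun x => x - a)} by move=> x y _ _ /addIr.
have FP x : x \in F -> [/\ x \in J, ltv 0 x, x \notin A, f x = a & ltv a x].
  rewrite !inE /= => /andP[/andP[xJ xA] /eqP fx].
  have x0 := Jpos _ xJ; split=> //; have [fxD fxx] := fD x x0.1.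
  split; first by rewrite -fx.
  (* If [a = x], then [x] would lie in [D], yet it is neither in [A] nor zero. *)
  move=> ax; move: fxD; rewrite fx ax !inE (negPf xA) andbF orbF => /eqP x_0.
  by case: x0 => _; apply.
have Kpos : [set` K] `<=` @pos_cone n.
  move=> y /= /imfsetP[x /FP[_ _ _ _ [ax nax]] ->]; split.
    by rewrite -(subrr a); apply/lev_subr.
  by move=> /esym/eqP; rewrite subr_eq0 => /eqP /esym.
have Kdown : downward_closed K.
  move=> _ y /imfsetP[x /FP[xJ x0 xA fx ax] ->] [y0 ny0] [yx nyx].
  (* Undoing the shift, [y + a] lies between [a = f x] and [x], so it has the same base point. *)
  have ay : lev a (y + a) by apply/(lev_subr a); rewrite subrr addrK.
  have yax : lev (y + a) x by apply/(lev_subr a); rewrite addrK.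
  have a0 : lev 0 a.
    have [+ _] := fD x x0.1; rewrite fx !inE => /orP[/eqP->|/andP[/Jpos[]//]].
    exact: lev_refl.
  have fy : f (y + a) = a by rewrite (fconst x) ?fx //; exact: x0.1.
  have yJ : y + a \in J.
    apply: (Jdown x) => //; split=> //.
    - exact: lev_trans ay.
    (* If [y + a = 0], then [y = - a] is both nonnegative and nonpositive, hence zero. *)
    - move=> /esym e; apply: ny0; apply/rowP => i; apply/le_anti.
      rewrite y0 /=; have := a0 i; rewrite -(addrK a y) e sub0r !mxE.
      by rewrite oppr_le0.
    - by move=> e; apply: nyx; rewrite -e addrK.
  apply/imfsetP; exists (y + a); last by rewrite addrK.
  (* A point [y + a] of [A] would be in [D] and fixed by [f], so equal to [a], forcing [y = 0]. *)
  rewrite /= !inE yJ fy eqxx andbT /=; apply/negP => yA.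
  have yD : y + a \in D by rewrite !inE yJ yA orbT.
  apply: ny0; apply/esym/eqP; rewrite -(inj_eq (addIr a)) add0r -{2}fy.
  by rewrite fid.
have := density_mul_card_le R B Kpos Kdown.
rewrite card_fset_sum1 natr_sum !big_imfset //= !big_filter.
by move/le_trans; apply; apply: ler_sum => x /eqP ->.
Qed.

Lemma sumset_card_ge (R : realType) (n : nat) (A B : set 'rV[int]_n)
    (J : {fset 'rV[int]_n}) : @down_sets n J ->
  \sum_(x <- J) (x \in A)%:R + density R B * \sum_(x <- J) (x \notin A)%:R
    <= \sum_(x <- J) (x \in sumset A B)%:R.
Proof.
move=> dJ; have [_ Jpos _] := dJ.
have [||f [fD fconst fid]] :=
    @base_point_exists n (0 |` [fset x in J | x \in A])%fset.
- by rewrite !inE eqxx.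
- move=> a; rewrite !inE => /orP[/eqP->|/andP[/Jpos[]//]]; exact: lev_refl.
have BN : density R B * \sum_(x <- J) (x \notin A)%:R
    <= \sum_(x <- J | x \notin A) (x - f x \in B)%:R.
  rewrite -card_fset_pred card_fset_sum1 natr_sum [leRHS]big_fset_condE /=.
  (* Both sums are grouped by the value of [f], which reduces the claim to single fibres. *)
  rewrite [in leLHS](partition_big_imfset _ f).
  rewrite [in leRHS](partition_big_imfset _ f).
  rewrite /= mulr_sumr.
  by apply: ler_sum => a _; apply: fibre_density.
apply: le_trans (lerD (lexx _) BN) _.
(* The comparison is now pointwise in [x]: either [x = x + 0] with [x] in [A], or
   [x = f x + (x - f x)] with [x - f x] in [B]. Indexing by [x] itself rules out double counting. *)
rewrite [X in _ + X]big_mkcond -big_split /= !big_seq; apply: ler_sum => x xJ.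
case: (boolP (x \in A)) => [xA|xA] /=.
  rewrite addr0; have -> // : x \in sumset A B.
  apply/mem_set; exists x; first by left; apply/set_mem.
  by exists 0; [right|rewrite addr0].
rewrite add0r; case: (boolP (_ \in B)) => // xB; have -> // : x \in sumset A B.
have [fxD _] := fD x (Jpos _ xJ).1.
apply/mem_set; exists (f x).
  by move: fxD; rewrite !inE => /orP[/eqP->|/andP[_ /set_mem]]; [right|left].
by exists (x - f x); [left; apply/set_mem|rewrite addrC subrK].
Qed.

Theorem theorem4p1 (R : realType) (n : nat) (hn : (1 <= n)%N)
    (A B : set 'rV[int]_n) (alpha beta : R)
    (hA : A `<=` @pos_cone n) (hB : B `<=` @pos_cone n)
    (hAalpha : density R A = alpha) (hBbeta : density R B = beta) :
  alpha + beta - alpha * beta <= density R (sumset A B).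
Proof.
have [[J0 dJ0]|noJ] := pselect (@down_sets n !=set0); last first.
  (* Without down-sets each density is the infimum of the empty set, [0] by convention, and the
     claim reads [0 <= 0]. *)
  have d0 (C : set 'rV[int]_n) : density R C = 0.
    rewrite -(inf0 R); congr (inf _); apply/seteqP; split=> // r [J dJ _].
    by case: noJ; exists J.
  by rewrite -hAalpha -hBbeta !d0 mulr0 subr0 addr0.
apply: lb_le_inf; first by eexists; exists J0.
move=> _ [J dJ <-]; have [Jn0 Jpos Jdown] := dJ.
rewrite ler_pdivlMr ?ltr0n ?cardfs_gt0// card_fset_pred.
apply: le_trans (sumset_card_ge R A B dJ).
have alphaJ := density_mul_card_le R A Jpos Jdown.
have beta1 := density_le1 R B dJ.
have cardJ : \sum_(x <- J) (x \notin A)%:R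
    = #|` J|%:R - \sum_(x <- J) (x \in A)%:R :> R.
  rewrite card_fset_sum1 natr_sum -sumrB; apply: eq_bigr => x _.
  by case: (x \in A); rewrite ?subrr ?subr0.
rewrite cardJ -hBbeta -hAalpha -subr_ge0.
set a := \sum_(_ <- _) _ in alphaJ *; set j := #|` _|%:R in alphaJ *.
(* The difference of the two sides factors; the first factor is nonnegative by [beta1], the second
   by [alphaJ]. *)
have -> : a + density R B * (j - a)
      - (density R A + density R B - density R A * density R B) * j
    = (1 - density R B) * (a - density R A * j) by ring.
by apply: mulr_ge0; rewrite subr_ge0.
Qed.
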